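(* Let $\Phi=\{\varphi_n\}_{n=1}^N\subseteq\mathbb{C}^M$ and let $\mathcal{A}\colon\mathbb{C}^M/\mathbb{T}\rightarrow\mathbb{R}^N$ be defined by $(\mathcal{A}(x))(n):=|\langle x,\varphi_n\rangle|^2$. Then $\mathcal{A}$ is injective if and only if the following statement holds for all $x,y\in\mathbb{C}^M$: if for every $n=1,\ldots,N$, either $\arg(\langle x,\varphi_n\rangle^2)=\arg(\langle y,\varphi_n\rangle^2)$ or one of the two sides is not well-defined, then $x=0$, $y=0$, or $y=cx$ for some $c\in\mathbb{R}\setminus\{0\}$.
   Context: $\mathbb{T}=\{c\in\mathbb{C}:|c|=1\}$. $\mathbb{C}^M/\mathbb{T}$ denotes $\mathbb{C}^M$ with $x$ and $y$ identified whenever $y=cx$ for some $c\in\mathbb{T}$; injectivity of $\mathcal{A}$ means: $\mathcal{A}(x)=\mathcal{A}(y)$ implies $y=cx$ for some $c\in\mathbb{T}$. The inner product on $\mathbb{C}^M$ is $\langle x,\varphi\rangle=\varphi^*x$. The argument $\arg(z)$ of a complex number $z$ is taken modulo $2\pi$, and is not well-defined exactly when $z=0$. *)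

(* Defs.v *)
From HB Require Import structures.
From mathcomp Require Import all_boot all_order all_algebra.
From mathcomp Require Import complex.
From mathcomp Require Import boolp classical_sets reals trigo.
From mathcomp Require Import lra.

Set Implicit Arguments.
Unset Strict Implicit.
Unset Printing Implicit Defensive.

Import Order.TTheory GRing.Theory Num.Theory.
Import ComplexField.Normc.

Local Open Scope ring_scope.
Local Open Scope complex_scope.
Local Open Scope sesquilinear_scope.
Local Open Scope classical_set_scope.

Section Defs.
Context {R : realType}.

Definition inner {M : nat} (x phi : 'cV[R[i]]_M) : R[i] :=
  (phi ^t* *m x) 0 0.

Definition intensity {M N : nat} (Phi : 'I_N -> 'cV[R[i]]_M)
    (x : 'cV[R[i]]_M) : 'rV[R]_N :=
  \row_n normc (inner x (Phi n)) ^+ 2.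

(* Injectivity of the map that A induces on C^M / T; for A = intensity Phi this
   map is well defined by intensity_phase. *)
Definition injective_mod_phase {M N : nat}
    (A : 'cV[R[i]]_M -> 'rV[R]_N) : Prop :=
  forall x y, A x = A y -> exists2 c : R[i], normc c = 1 & y = c *: x.

(* An argument modulo 2 pi is a coset of 2 pi Z, here the set of all real
   determinations t of z = |z| e^(it) (see arg_coset); None encodes "not
   well-defined". *)
Definition arg (z : R[i]) : option (set R) :=
  if z == 0 then None
  else Some [set t : R | z = (normc z)%:C * (cos t +i* sin t)].

End Defs.

Lemma intensity_phase (R : realType) (M N : nat) (Phi : 'I_N -> 'cV[R[i]]_M)
    (x : 'cV[R[i]]_M) (c : R[i]) :
  normc c = 1 -> intensity Phi (c *: x) = intensity Phi x.
Proof.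
move=> c1; apply/rowP => n; rewrite !mxE /inner -scalemxAr mxE normcM c1.
by rewrite mul1r.
Qed.

Lemma arg_undef (R : realType) (z : R[i]) : arg z = None <-> z = 0.
Proof. by rewrite /arg; case: eqP. Qed.

Lemma periodicz (R : realType) (f : R -> R) (T : R) :
  periodic f T -> forall (k : int) t, f (t + k%:~R * T) = f t.
Proof.
move=> fT k t; rewrite mulrzl; case: k => n; first exact: (periodicn fT n).
by rewrite NegzE mulrNz -pmulrn -[LHS](periodicn fT n.+1) subrK.
Qed.

Lemma cos_eq1 (R : realType) (t : R) :
  cos t = 1 -> exists k : int, t = k%:~R * (pi *+ 2).
Proof.
move=> ct1; have pi0 : 0 < pi :> R by exact: pi_gt0.
have pi20 : 0 < pi *+ 2 :> R by rewrite mulr2n addr_gt0.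
pose k := Num.floor (t / (pi *+ 2)); exists k.
pose e := t - k%:~R * (pi *+ 2).
have te : t = e + k%:~R * (pi *+ 2) by rewrite subrK.
have ce : cos e = 1 by rewrite -ct1 [in RHS]te (periodicz (@cosD2pi R)).
have e0 : 0 <= e by rewrite subr_ge0 -ler_pdivlMr // floor_le.
have e2 : e < pi *+ 2.
  rewrite ltrBlDr -[X in X + _]mul1r -mulrDl -ltr_pdivrMr // addrC.
  by have := floorD1_gt (t / (pi *+ 2)); rewrite intrD.
suff e_eq0 : e = 0 by rewrite te e_eq0 add0r.
have [epi|epi] := leP e pi.
  by apply: cos_inj; rewrite ?in_itv /= ?e0 ?epi ?lexx ?(ltW pi0) ?ce ?cos0.
suff h : pi *+ 2 - e = 0 by move: e2; rewrite -subr_gt0 h ltxx.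
have h1 : 0 <= pi *+ 2 - e by rewrite subr_ge0 ltW.
have h2 : pi *+ 2 - e <= pi by move: epi; rewrite mulr2n; lra.
apply: cos_inj; rewrite ?in_itv /= ?h1 ?h2 ?lexx ?(ltW pi0) //.
by rewrite cos0 cosB cos2pi sin2pi ce mul1r mul0r addr0.
Qed.

Lemma arg_coset (R : realType) (z : R[i]) : z != 0 ->
  exists t : R, arg z = Some [set s | exists k : int, s = t + k%:~R * (pi *+ 2)].
Proof.
move=> z0; pose r := normc z.
have r0 : r != 0 by apply: contra z0 => /eqP/eq0_normc ->.
have [a [b [zE ab1]]] :
    exists a b : R, z = r%:C * (a +i* b) /\ a ^+ 2 + b ^+ 2 = 1.
  have r2 : complex.Re z ^+ 2 + complex.Im z ^+ 2 = r ^+ 2.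
    rewrite /r; case: (z) => x y /=; rewrite sqr_sqrtr //.
    by apply: addr_ge0; exact: sqr_ge0.
  clearbody r; case: z r2 {z0} => x y /= r2.
  exists (x / r), (y / r); split.
    by apply/eqP; rewrite eq_complex /= !mul0r subr0 addr0 ![r * _]mulrC !divfK ?eqxx.
  by rewrite !expr_div_n -mulrDl r2 divff // sqrf_eq0.
have a1 : -1 <= a <= 1.
  rewrite -ler_norml -(@expr_le1 _ 2) // real_normK ?num_real //.
  by rewrite -ab1 lerDl sqr_ge0.
pose t := if 0 <= b then acos a else - acos a.
have ct : cos t = a by rewrite /t; case: ifP => _; rewrite ?cosN acosK ?in_itv.
have st : sin t = b.
  have -> : b = if 0 <= b then `|b| else - `|b|.
    by case: ger0P; rewrite ?opprK.
  have sa : sin (acos a) = `|b|.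
    by rewrite sin_acos // -sqrtr_sqr -ab1 [X in X - _]addrC addrK.
  by rewrite /t; case: ifP => _; rewrite ?sinN sa.
exists t; rewrite /arg (negbTE z0); congr Some.
apply/seteqP; split=> s /=; rewrite -/r; last first.
  by case=> k ->; rewrite (periodicz (@cosD2pi R)) (periodicz (@sinD2pi R)) ct st.
rewrite {1}zE => zs.
have rC0 : r%:C != 0 :> R[i] by apply: contra r0 => /eqP[->].
have [as_ bs] := mulfI rC0 zs.
have [|k kE] := @cos_eq1 R (s - t).
  by rewrite cosB ct st -as_ -bs -!expr2.
by exists k; rewrite -kE addrC subrK.
Qed.

(* Main.v *)
Require Import Defs.
From mathcomp Require Import all_boot all_order all_algebra.
From mathcomp Require Import complex.
From mathcomp Require Import boolp classical_sets reals trigo.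
From mathcomp Require Import ring.

Import GRing.Theory Num.Theory.

Local Open Scope ring_scope.
Local Open Scope complex_scope.

(* Two nonzero complex numbers a, b have squares with equal arguments exactly
   when a / b is real, that is, when a conj(b) is real; a vanishing a or b also
   makes a conj(b) real. Since |u + v|^2 - |u - v|^2 = 4 Re (u conj(v)), the
   hypothesis on (x, y) says that x + iy and x - iy have the same intensities.
   Equality of these two vectors up to a unit factor c corresponds, by the Cayley
   transform c = (1 - ir) / (1 + ir), to y = r x with r real, the degenerate
   values r = 0 and r = oo giving y = 0 and x = 0. *)

Lemma sqr_normcC (R : rcfType) (z : R[i]) :
  (ComplexField.Normc.normc z ^+ 2)%:C = z * z^*%C.
Proof. by rewrite rmorphXn -sqr_normc. Qed.

Lemma normc_eq1 (R : rcfType) (z : R[i]) :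
  ComplexField.Normc.normc z = 1 <-> z * z^*%C = 1.
Proof.
rewrite -sqr_normcC; split=> [->|/(@complexI _ _ 1)/eqP]; first by rewrite expr1n.
by rewrite sqrp_eq1 ?sqrtr_ge0 => [/eqP//|]; case: z => a b; exact: sqrtr_ge0.
Qed.

(** Products with the conjugate replace the square roots in [normc], so that later steps are
    identities for [ring]. *)
Lemma intensity_eqP (R : realType) (M N : nat) (Phi : 'I_N -> 'cV[R[i]]_M)
    (x y : 'cV[R[i]]_M) :
  intensity Phi x = intensity Phi y <->
  forall n, inner x (Phi n) * (inner x (Phi n))^*%C =
            inner y (Phi n) * (inner y (Phi n))^*%C.
Proof.
split=> [/rowP xy n|xy]; first by rewrite -!sqr_normcC; have := xy n; rewrite !mxE => ->.
by apply/rowP => n; rewrite !mxE; apply: complexI; rewrite !sqr_normcC.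
Qed.

Lemma innerDZl (R : realType) (M : nat) (c : R[i]) (x y phi : 'cV[R[i]]_M) :
  inner (x + c *: y) phi = inner x phi + c * inner y phi.
Proof. by rewrite /inner mulmxDr -scalemxAr !mxE. Qed.

(** The determinations of a nonzero z depend only on z / |z|; cross-multiplication compares two such
    quotients without division. *)
Lemma arg_eqP (R : realType) (z w : R[i]) : z != 0 -> w != 0 ->
  arg z = arg w <->
  (ComplexField.Normc.normc w)%:C * z = (ComplexField.Normc.normc z)%:C * w.
Proof.
move=> z0 w0.
have nz u : u != 0 :> R[i] -> (ComplexField.Normc.normc u)%:C != 0 :> R[i].
  by apply: contra => /eqP/(@complexI _ _ 0)/ComplexField.Normc.eq0_normc ->.
have [s zs] := arg_coset z0.
split=> [zw|zw].
  have [zt wt] : (z = (ComplexField.Normc.normc z)%:C * (cos s +i* sin s)) /\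
                 (w = (ComplexField.Normc.normc w)%:C * (cos s +i* sin s)).
    (* The representative s of the coset of z is itself a determination (k = 0), hence also one for
       any u with the same argument. *)
    have hs u : u != 0 -> arg u = arg z ->
        u = (ComplexField.Normc.normc u)%:C * (cos s +i* sin s).
      move=> u0; rewrite zs /arg (negbTE u0) => -[/seteqP[_ /(_ s)]]; apply.
      by exists 0; rewrite mul0r addr0.
    by split; apply: hs.
  by rewrite {1}zt {2}wt mulrCA.
rewrite /arg (negbTE z0) (negbTE w0); congr Some; apply/seteqP; split=> t /= h.
  by apply: (mulfI (nz _ z0)); rewrite -zw {1}h mulrCA.
by apply: (mulfI (nz _ w0)); rewrite zw {1}h mulrCA.
Qed.

Lemma arg_sqr_eqP (R : realType) (a b : R[i]) :
  [\/ arg (a ^+ 2) = arg (b ^+ 2), arg (a ^+ 2) = None | arg (b ^+ 2) = None] <->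
  a * b^*%C = a^*%C * b.
Proof.
have [->|a0] := eqVneq a 0.
  rewrite conjc0 !mul0r; split=> // _.
  by apply: Or32; apply/arg_undef; rewrite expr0n.
have [->|b0] := eqVneq b 0.
  rewrite conjc0 !mulr0; split=> // _.
  by apply: Or33; apply/arg_undef; rewrite expr0n.
have a20 : a ^+ 2 != 0 by rewrite expf_neq0.
have b20 : b ^+ 2 != 0 by rewrite expf_neq0.
have normcX2 (z : R[i]) : (ComplexField.Normc.normc (z ^+ 2))%:C = z * z^*%C.
  by rewrite expr2 ComplexField.Normc.normcM -expr2 sqr_normcC.
have argE : arg (a ^+ 2) = arg (b ^+ 2) <-> a * b^*%C = a^*%C * b.
  (* Since |z^2| = z conj(z), the criterion becomes b conj(b) a^2 = a conj(a) b^2, which is the goal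
     multiplied by ab. *)
  apply: (iff_trans (arg_eqP _ _ _ a20 b20)); rewrite !normcX2; split=> h.
    apply: (mulfI (mulf_neq0 a0 b0)).
    by transitivity (b * b^*%C * a ^+ 2); [ring | rewrite h; ring].
  transitivity (a * b * (a * b^*%C)); [ring | rewrite h; ring].
split=> [[/argE//|/arg_undef/eqP|/arg_undef/eqP]|/argE]; last exact: Or31.
  by rewrite (negbTE a20).
by rewrite (negbTE b20).
Qed.

(* The left-hand side is the form to which /= reduces the conjugate of 'i. *)
Lemma conjc_i (R : rcfType) : 0 -i* 1 = - 'i%C :> R[i].
Proof. by apply/eqP; rewrite eq_complex /= oppr0 !eqxx. Qed.

(* Polarization: |a + ib|^2 - |a - ib|^2 = 4 Im (a conj(b)). *)
Lemma sqr_normc_conj_eqP (R : rcfType) (a b : R[i]) :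
  (a + 'i%C * b) * (a + 'i%C * b)^*%C = (a + - 'i%C * b) * (a + - 'i%C * b)^*%C <->
  a * b^*%C = a^*%C * b.
Proof.
have i0 : 'i%C != 0 :> R[i] by rewrite eq_complex /= oner_eq0 andbF.
have i2 : 2 * 'i%C != 0 :> R[i] by rewrite mulf_neq0 // pnatr_eq0.
rewrite !rmorphD !rmorphM rmorphN /= conjc_i; split=> h; last first.
  by apply/eqP; rewrite -subr_eq0; apply/eqP; ring: h.
(* The two sides of [h] differ by -2i (a conj(b) - conj(a) b), hence the factor [i2] and the change
   of sign. *)
apply: (mulfI i2); apply/eqP; rewrite -subr_eq0 -oppr_eq0; apply/eqP.
by move/eqP: h; rewrite -subr_eq0 => /eqP <-; ring.
Qed.

Lemma realCP (R : rcfType) (z : R[i]) : z^*%C = z -> exists r : R, z = r%:C.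
Proof.
case: z => a b [] /eqP; rewrite eq_sym -subr_eq0 opprK -mulr2n mulrn_eq0 /=.
by move=> /eqP ->; exists a.
Qed.

(** As conj(c) = 1 / c, conjugation fixes the quotient, the inverse Cayley transform of c. *)
Lemma cayley_real (R : rcfType) (c : R[i]) : c * c^*%C = 1 -> 1 + c != 0 ->
  exists r : R, - 'i%C * (1 - c) / (1 + c) = r%:C.
Proof.
move=> c1 c0; apply: realCP.
have cc0 : 1 + c^*%C != 0 by rewrite -conjc1 -rmorphD conjc_eq0.
rewrite !rmorphM fmorphV rmorphN rmorphB rmorphD rmorph1 /= conjc_i.
apply/eqP; rewrite eqr_div //; apply/eqP; ring: c1.
Qed.

Lemma phase_cayleyP (R : rcfType) (M : nat) (x y : 'cV[R[i]]_M) :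
  (exists2 c : R[i], ComplexField.Normc.normc c = 1 &
     x + - 'i%C *: y = c *: (x + 'i%C *: y)) <->
  [\/ x = 0, y = 0 | exists2 r : R, r != 0 & y = r%:C *: x].
Proof.
have sqri : ('i%C : R[i]) ^+ 2 = -1 := sqr_i R.
have ii : - 'i%C * 'i%C = 1 :> R[i] by rewrite mulNr -expr2 sqri opprK.
split=> [[c /normc_eq1 c1 xy]|].
  have xyE : (1 - c) *: x = 'i%C * (1 + c) *: y.
    move/eqP: xy; rewrite scalerDr scalerA -subr_eq0 => /eqP xy.
    apply/eqP; rewrite -subr_eq0 -[X in _ == X]xy; apply/eqP/colP => j; rewrite !mxE; ring.
  (* The pole c = -1 corresponds to r = oo: there [xyE] reads 2 x = 0. *)
  have [c0|c0] := eqVneq (1 + c) 0.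
    apply: Or31; move/eqP: xyE; rewrite c0 mulr0 scale0r scaler_eq0.
    have -> : c = -1 by apply/eqP; rewrite -subr_eq0 opprK addrC c0.
    by rewrite opprK -[1 + 1]/(2%:R) pnatr_eq0 => /eqP.
  have [r rE] := cayley_real _ _ c1 c0.
  have yE : y = r%:C *: x.
    rewrite -rE mulrAC -scalerA xyE scalerA -[LHS]scale1r; congr (_ *: _).
    by rewrite mulrACA mulrA ii mul1r mulrC divff.
  have [r0|r0] := eqVneq r 0; first by apply: Or32; rewrite yE r0 scale0r.
  by apply: Or33; exists r.
case=> [->|->|[r r0 ->]].
- exists (-1); first by apply/normc_eq1; rewrite rmorphN rmorph1 mulrNN mulr1.
  by rewrite !add0r scaleN1r scaleNr.
- by exists 1; rewrite ?scaler0 ?scale1r //; apply/normc_eq1; rewrite rmorph1 mulr1.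
have d0 : 1 + 'i%C * r%:C != 0 :> R[i].
  by rewrite eq_complex /= !mul0r !mul1r !subr0 addr0 oner_eq0.
(* Of r only conj(z) = z and 1 + iz != 0 are kept, so that [field] sees z as an atom. *)
move: (r%:C) (conjc_real r) d0 => z zz d0.
have dc0 : 1 - 'i%C * z != 0 :> R[i].
  have -> : 1 - 'i%C * z = (1 + 'i%C * z)^*%C.
    by rewrite rmorphD rmorph1 rmorphM /= conjc_i zz mulNr.
  by rewrite conjc_eq0.
exists ((1 - 'i%C * z) / (1 + 'i%C * z)).
  apply/normc_eq1; rewrite rmorphM fmorphV rmorphB rmorphD rmorph1 rmorphM /=.
  by rewrite conjc_i zz !mulNr opprK; field; rewrite d0 dc0.
by apply/colP => j; rewrite !mxE; field.
Qed.

Lemma intensity_conj_eqP (R : realType) (M N : nat) (Phi : 'I_N -> 'cV[R[i]]_M)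
    (x y : 'cV[R[i]]_M) :
  intensity Phi (x + 'i%C *: y) = intensity Phi (x + - 'i%C *: y) <->
  forall n : 'I_N,
    [\/ arg (inner x (Phi n) ^+ 2) = arg (inner y (Phi n) ^+ 2),
        arg (inner x (Phi n) ^+ 2) = None
      | arg (inner y (Phi n) ^+ 2) = None].
Proof.
apply: (iff_trans (intensity_eqP _ _ _ _ _ _)).
split=> h n; have := h n.
  by rewrite !innerDZl => /sqr_normc_conj_eqP/arg_sqr_eqP.
by move/arg_sqr_eqP/sqr_normc_conj_eqP; rewrite !innerDZl.
Qed.

Theorem theorem5 (R : realType) (M N : nat) (Phi : 'I_N -> 'cV[R[i]]_M) :
  injective_mod_phase (intensity Phi) <->
  (forall x y : 'cV[R[i]]_M,
     (forall n : 'I_N,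
        [\/ arg (inner x (Phi n) ^+ 2) = arg (inner y (Phi n) ^+ 2),
            arg (inner x (Phi n) ^+ 2) = None
          | arg (inner y (Phi n) ^+ 2) = None]) ->
     [\/ x = 0, y = 0 | exists2 c : R, c != 0 & y = c%:C *: x]).
Proof.
split=> [inj x y /intensity_conj_eqP xy|h u v uv].
  exact/phase_cayleyP/inj.
have sqri : ('i%C : R[i]) ^+ 2 = -1 := sqr_i R.
(* The solution of u = x + iy, v = x - iy: every pair (u, v) has this form. *)
pose x := 2^-1 *: (u + v); pose y := (- 'i%C / 2) *: (u - v).
have uE : u = x + 'i%C *: y.
  by apply/colP => j; rewrite !mxE; field: sqri.
have vE : v = x + - 'i%C *: y.
  by apply/colP => j; rewrite !mxE; field: sqri.
rewrite uE vE; apply/phase_cayleyP/h/intensity_conj_eqP.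
by rewrite -uE -vE.
Qed.
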